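(* If $Q\in\mathcal{N}_{\kappa}(\mathcal{H})$ is holomorphic at infinity and $Q'(\infty):=\lim_{z\to\infty}zQ(z)$ is invertible, then $\ker Q=\{0\}$, where $\ker Q:=\bigcap_{z\in\mathcal{D}(Q)}\ker Q(z)$.
   Context: $(\mathcal{H},(\cdot,\cdot))$ is a Hilbert space and $\mathcal{L}(\mathcal{H})$ the space of bounded operators on it. For an integer $\kappa\ge 0$, $\mathcal{N}_\kappa(\mathcal{H})$ is the class of functions $Q:\mathcal{D}(Q)\to\mathcal{L}(\mathcal{H})$ that are meromorphic in $\mathbb{C}\setminus\mathbb{R}$, satisfy $Q(z)^*=Q(\bar z)$, and whose kernel $\mathcal{N}_Q(z,w)=\frac{Q(z)-Q(w)^*}{z-\bar w}$, $z,w\in\mathcal{D}(Q)\cap\mathbb{C}^+$, has $\kappa$ negative squares (every Hermitian matrix $((\mathcal{N}_Q(z_i,z_j)h_i,h_j))_{i,j=1}^n$ has at most $\kappa$ negative eigenvalues, and for at least one choice of $n,z_i,h_i$ exactly $\kappa$). $\mathcal{D}(Q)$ is the domain of holomorphy of $Q$. ''$Q$ is holomorphic at $\infty$'' means that $Q$ is holomorphic in a neighbourhood of $\infty$ and the limit $Q'(\infty):=\lim_{z\to\infty}zQ(z)$ exists in the operator norm (so $Q(\infty)=0$). *)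

(* Defs.v *)
From HB Require Import structures.
From mathcomp Require Import all_boot all_order all_algebra sesquilinear.
From mathcomp Require Import complex.
From mathcomp Require Import all_classical all_reals all_analysis.

Set Implicit Arguments.
Unset Strict Implicit.
Unset Printing Implicit Defensive.

Import Order.TTheory GRing.Theory Num.Theory.
Import numFieldNormedType.Exports.

Local Open Scope classical_set_scope.
Local Open Scope ring_scope.

(* The library puts the metric topology on R[i]^o, not on R[i] itself. *)
HB.instance Definition _ (R : realType) := NormedModule.copy R[i] (R[i])^o.

Section BoundedOperators.
Context {R : realType} {H : normedModType R[i]}.

Definition bounded_op (f : H -> H) : Prop :=
  linear f /\ exists M : R, forall x, `|f x| <= M%:C%C * `|x|.

Definition bopred : {pred H -> H} := fun f => `[< bounded_op f >].

Record bop := Bop { bop_fun :> H -> H ; _ : bop_fun \in bopred }.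

HB.instance Definition _ := [isSub for bop_fun].
HB.instance Definition _ := gen_eqMixin bop.
HB.instance Definition _ := gen_choiceMixin bop.

Lemma bopP (A : bop) : bounded_op A.
Proof. by case: A => f /= /asboolP. Qed.

Fact bop_submod : GRing.submod_closed bopred.
Proof.
split.
  apply/asboolP; split=> [a x y|]; first by rewrite /= scaler0 addr0.
  by exists 0 => x; rewrite normr0 mul0r.
move=> a f g /asboolP[lf [M Mf]] /asboolP[lg [N Ng]]; apply/asboolP; split.
  move=> b x y; rewrite !fctE /= lf lg !scalerDr !scalerA (mulrC a b).
  by rewrite -!addrA; congr (_ + _); rewrite addrCA.
have aR : `|a| = (complex.Re `|a|)%:C%C by rewrite RRe_real // normr_real.
exists (complex.Re `|a| * M + N) => x.
rewrite rmorphD rmorphM /= -aR mulrDl -mulrA.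
rewrite (le_trans (ler_normD _ _))// lerD// normrZ.
by rewrite ler_wpM2l.
Qed.

HB.instance Definition _ :=
  GRing.isSubmodClosed.Build R[i] (H -> H) bopred bop_submod.
HB.instance Definition _ := [SubChoice_isSubLmodule of bop by <:].

Definition opnorm (A : bop) : R :=
  sup [set complex.Re `|A x| | x in [set x | `|x| <= 1]].

Lemma normRe (x : H) : `|x| = (complex.Re `|x|)%:C%C.
Proof. by rewrite RRe_real // normr_real. Qed.

Lemma bopD (A B : bop) x : (A + B) x = A x + B x.
Proof. by []. Qed.

Lemma bopZ a (A : bop) x : (a *: A) x = a *: A x.
Proof. by []. Qed.

Lemma bop0 x : (0 : bop) x = 0.
Proof. by []. Qed.

Lemma bop_linear (A : bop) : linear A.
Proof. by case: (bopP A). Qed.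

Lemma bopr0 (A : bop) : A 0 = 0.
Proof. by have := bop_linear A (-1) 0 0; rewrite scaler0 addr0 scaleN1r addNr. Qed.

Lemma boprZ (A : bop) a x : A (a *: x) = a *: A x.
Proof. by have := bop_linear A a x 0; rewrite bopr0 !addr0. Qed.

Lemma opnorm_has_sup (A : bop) :
  has_sup [set complex.Re `|A x| | x in [set x | `|x| <= 1]].
Proof.
split; first by exists (complex.Re `|A 0|), 0 => //=; rewrite normr0.
have [_ [M AM]] := bopP A; exists `|M| => _ [x /= x1 <-].
rewrite -lecR -normRe (le_trans (AM x))//.
rewrite (@le_trans _ _ (`|M|%:C%C * `|x|))//.
  by rewrite ler_wpM2r// lecR ler_norm.
by rewrite -[leRHS]mulr1 ler_wpM2l// lecR.
Qed.

Lemma opnorm_ge0 (A : bop) : 0 <= opnorm A.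
Proof.
have [_ ub] := opnorm_has_sup A.
by apply: ub_le_sup => //; exists 0; rewrite /= ?normr0// bopr0 normr0.
Qed.

Lemma ler_opnorm (A : bop) x : `|A x| <= (opnorm A)%:C%C * `|x|.
Proof.
have [->|x0] := eqVneq x 0; first by rewrite bopr0 !normr0 mulr0.
have nx : 0 < `|x| by rewrite normr_gt0.
rewrite -ler_pdivrMr//.
have -> : `|A x| / `|x| = `|A (`|x|^-1 *: x)|.
  by rewrite boprZ normrZ normfV normr_id mulrC.
rewrite normRe lecR; have [_ ub] := opnorm_has_sup A.
apply: ub_le_sup => //; exists (`|x|^-1 *: x) => //=.
by rewrite normrZ normfV normr_id mulVf// gt_eqF.
Qed.

Lemma opnorm_le (A : bop) (M : R) : 0 <= M ->
  (forall x, `|A x| <= M%:C%C * `|x|) -> opnorm A <= M.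
Proof.
move=> M0 AM; apply: ge_sup; first by case: (opnorm_has_sup A).
move=> _ [x /= x1 <-]; rewrite -lecR -normRe (le_trans (AM x))//.
by rewrite -[leRHS]mulr1 ler_wpM2l// lecR.
Qed.

Definition bop_norm (A : bop) : R[i] := (opnorm A)%:C%C.

Fact bop_normD A B : bop_norm (A + B) <= bop_norm A + bop_norm B.
Proof.
rewrite /bop_norm -rmorphD lecR; apply: opnorm_le.
  by rewrite addr_ge0// opnorm_ge0.
move=> x; rewrite bopD (le_trans (ler_normD _ _))// rmorphD mulrDl.
by rewrite lerD// ler_opnorm.
Qed.

Fact bop_normZ_le a A : bop_norm (a *: A) <= `|a| * bop_norm A.
Proof.
have aR : `|a| = (complex.Re `|a|)%:C%C by rewrite RRe_real // normr_real.
rewrite /bop_norm aR -rmorphM lecR; apply: opnorm_le.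
  rewrite mulr_ge0 ?opnorm_ge0// -lecR -aR; exact: normr_ge0.
move=> x; rewrite bopZ normrZ rmorphM /= -aR -mulrA.
by rewrite ler_wpM2l// ler_opnorm.
Qed.

Fact bop_normZ a A : bop_norm (a *: A) = `|a| * bop_norm A.
Proof.
have [->|a0] := eqVneq a 0.
  apply/eqP; rewrite scale0r normr0 mul0r eq_le; apply/andP; split.
    by have := bop_normZ_le 0 A; rewrite scale0r normr0 mul0r.
  by rewrite lecR opnorm_ge0.
apply/eqP; rewrite eq_le bop_normZ_le /=.
have na : 0 < `|a| by rewrite normr_gt0.
rewrite -ler_pdivlMl// -normfV.
by rewrite -{1}[A](scalerK a0) bop_normZ_le.
Qed.

Fact bop_norm_eq0 A : bop_norm A = 0 -> A = 0.
Proof.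
move=> A0; apply: val_inj; apply/funext => x /=.
apply/eqP; rewrite -normr_le0 (le_trans (ler_opnorm A x))//.
by rewrite -/(bop_norm A) A0 mul0r.
Qed.

HB.instance Definition _ :=
  Lmodule_isNormed.Build R[i] bop bop_normD bop_normZ bop_norm_eq0.

End BoundedOperators.

Arguments bop {R} H.

Section NevanlinnaClass.
Context {R : realType} {H : completeNormedModType R[i]}.
Variable ip : {dot H for Num.conj}.

Definition is_adjoint (A B : bop H) := forall x y, ip (A x) y = ip x (B y).

(* The adjoint exists by the Riesz representation theorem and is unique
   (adjoint_unique); the default value 0 of xget is never used. *)
Definition adjoint (A : bop H) : bop H := xget 0 [set B | is_adjoint A B].

Lemma adjoint_unique (A B C : bop H) :
  is_adjoint A B -> is_adjoint A C -> B = C.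
Proof.
move=> AB AC; apply: val_inj; apply/funext => y /=; apply/eqP.
rewrite -subr_eq0; apply: contraT => /(@neq0_dnorm_gt0 _ _ _ ip).
by rewrite linearBr/= -AB -AC subrr ltxx.
Qed.

Lemma adjointE (A B : bop H) : is_adjoint A B -> adjoint A = B.
Proof.
move=> AB; rewrite /adjoint; case: xgetP => [C _ AC|/(_ B)//].
exact: adjoint_unique AC AB.
Qed.

Definition holomorphic_in (U : set R[i]) (F : R[i] -> bop H) : Prop :=
  open U /\ forall z, U z -> derivable F z 1.

(* A function with values in L(H) is a domain D together with a total function
   Q, whose values outside D are irrelevant. D is dense in C in gen_nevanlinna
   below, since its complement there meets C \ R in isolated points only; so
   the last clause says that Q has no holomorphic extension beyond D. *)
Definition domain_of_holomorphy (D : set R[i]) (Q : R[i] -> bop H) : Prop :=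
  holomorphic_in D Q /\
  forall (U : set R[i]) (G : R[i] -> bop H), holomorphic_in U G ->
    (forall z, U z -> D z -> G z = Q z) -> U `<=` D.

Definition meromorphic_at (z0 : R[i]) (D : set R[i]) (Q : R[i] -> bop H) : Prop :=
  exists (n : nat) (U : set R[i]) (G : R[i] -> bop H),
    [/\ U z0, holomorphic_in U G &
        forall z, U z -> z != z0 -> D z /\ G z = (z - z0) ^+ n *: Q z].

Definition nevanlinna_kernel (Q : R[i] -> bop H) (z w : R[i]) : bop H :=
  (z - w^*)^-1 *: (Q z - adjoint (Q w)).

Definition nevanlinna_matrix (Q : R[i] -> bop H) n (z : 'I_n -> R[i])
    (h : 'I_n -> H) : 'M[R[i]]_n :=
  \matrix_(i, j) ip (nevanlinna_kernel Q (z i) (z j) (h i)) (h j).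

(* On R[i], x < 0 means that x is real and negative; eigenvalues are counted
   with multiplicity. *)
Definition neg_eigenvalues n (A : 'M[R[i]]_n) : nat :=
  count (fun x => x < 0) (sval (closed_field_poly_normal (char_poly A))).

Definition negative_squares (kappa : nat) (D : set R[i]) (Q : R[i] -> bop H) :=
  (forall n (z : 'I_n -> R[i]) (h : 'I_n -> H),
    (forall i, D (z i) /\ 0 < 'Im (z i)) ->
    (neg_eigenvalues (nevanlinna_matrix Q z h) <= kappa)%N) /\
  (exists n (z : 'I_n -> R[i]) (h : 'I_n -> H),
    (forall i, D (z i) /\ 0 < 'Im (z i)) /\
    neg_eigenvalues (nevanlinna_matrix Q z h) = kappa).

Record gen_nevanlinna (kappa : nat) (D : set R[i]) (Q : R[i] -> bop H) : Prop := {
  nevanlinna_domain : domain_of_holomorphy D Q ;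
  nevanlinna_meromorphic : forall z, 'Im z != 0 -> meromorphic_at z D Q ;
  nevanlinna_sym : forall z, D z -> D z^* /\ adjoint (Q z) = Q z^* ;
  nevanlinna_negative_squares : negative_squares kappa D Q
}.

Definition cinfty_nbhs : set_system R[i] :=
  [set A | exists r : R, forall z, r%:C%C < `|z| -> A z].

Global Instance cinfty_nbhs_filter : ProperFilter cinfty_nbhs.
Proof.
split.
  case=> r /(_ (`|r| + 1)%:C%C); apply.
  have r0 : 0 <= `|r| + 1 by rewrite addr_ge0.
  rewrite ger0_norm ?ltcR; last by rewrite lecR.
  by rewrite (le_lt_trans (ler_norm r))// ltrDl.
split.
- by exists 0.
- move=> A B [r Ar] [s Bs]; exists (Num.max r s) => z rsz.
  by split; [apply: Ar|apply: Bs]; apply: le_lt_trans rsz;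
    rewrite lecR le_max lexx ?orbT.
- by move=> A B AB [r Ar]; exists r => z /Ar /AB.
Qed.

(* Q'(oo), the derivative at infinity: the limit of z Q(z) in operator norm. *)
Definition deriv_infty (Q : R[i] -> bop H) : bop H :=
  lim ((z *: Q z) @[z --> cinfty_nbhs]).

(* Holomorphy in a neighbourhood of oo is expressed in the chart w = 1/z. *)
Definition holomorphic_at_infty (D : set R[i]) (Q : R[i] -> bop H) : Prop :=
  (exists (U : set R[i]) (G : R[i] -> bop H),
    [/\ U 0, holomorphic_in U G &
        forall w, U w -> w != 0 -> D w^-1 /\ G w = Q w^-1]) /\
  cvg ((z *: Q z) @[z --> cinfty_nbhs]).

Definition bop_invertible (A : bop H) : Prop :=
  exists B : bop H, cancel A B /\ cancel B A.

Definition ker_family (D : set R[i]) (Q : R[i] -> bop H) : set H :=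
  \bigcap_(z in D) [set h | Q z h = 0].

End NevanlinnaClass.

(* Main.v *)
(* If h lies in ker Q, then z Q(z) h = 0 for all large z, and letting z tend to
   infinity gives Q'(oo) h = 0, hence h = 0. *)
Require Import Defs.
From HB Require Import structures.
From mathcomp Require Import all_boot all_order all_algebra sesquilinear.
From mathcomp Require Import complex.
From mathcomp Require Import all_classical all_reals all_analysis.
Import Order.TTheory GRing.Theory Num.Theory.
Import numFieldNormedType.Exports.
Local Open Scope classical_set_scope.
Local Open Scope ring_scope.

(** Convergence in operator norm implies pointwise convergence. Every large [z] lies in [D]
    ([holomorphic_at_infty_domain]), so a common kernel vector is killed by [z *: Q z] near
    infinity, hence by the limit ([bop_lim_eq0]), which is injective. *)

Lemma holomorphic_at_infty_domain (R : realType)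
    (H : completeNormedModType R[i]) (D : set R[i]) (Q : R[i] -> bop H) :
  holomorphic_at_infty D Q -> cinfty_nbhs D.
Proof.
move=> [[U [G [U0 [oU _] UD]]] _].
have /nbhs_ballP[e /= e0 eU] : nbhs (0 : R[i]) U by exact: open_nbhs_nbhs.
have eR : e = (complex.Re e)%:C%C by rewrite RRe_real// gtr0_real.
(* The chart [1/z] carries the exterior of the disc of radius [1/e] into the ball of radius [e]
   about 0. *)
exists (complex.Re e)^-1 => z; rewrite fmorphV /= -eR => ez.
have nz : 0 < `|z| by rewrite (lt_trans _ ez)// invr_gt0.
have z0 : z != 0 by rewrite -normr_gt0.
have Uz : U z^-1.
  apply: eU; rewrite -ball_normE /= sub0r normrN normfV.
  by rewrite invf_plt.
by have [] := UD _ Uz (invr_neq0 z0); rewrite invrK.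
Qed.

(** If [A h] were nonzero, each [f x] killing [h] would stay at distance at least [|A h| / |h|] from
    [A], because [|A h| = |(A - f x) h|] is at most the operator norm of [A - f x] times [|h|]. *)
Lemma bop_lim_eq0 (R : realType) (H : normedModType R[i]) (T : Type)
    (F : set_system T) (FF : ProperFilter F) (f : T -> bop H) (A : bop H) (h : H) :
  f x @[x --> F] --> A -> (\forall x \near F, f x h = 0) -> A h = 0.
Proof.
move=> fA fh0; apply: contrapT => /eqP Ah0.
have h0 : h != 0 by apply: contra_neq Ah0 => ->; exact: bopr0.
have nh : 0 < `|h| by rewrite normr_gt0.
have e0 : 0 < `|A h| / `|h| by rewrite divr_gt0// normr_gt0.
have /cvgrPdist_lt/(_ _ e0) Ae := fA.
have [x [fxh]] := filter_ex (filterI fh0 Ae).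
rewrite ltr_pdivlMr// => /(le_lt_trans (ler_opnorm (A - f x) h)).
have -> : (A - f x) h = A h - f x h by [].
by rewrite fxh subr0 ltxx.
Qed.

Theorem proposition2p6 (R : realType) (H : completeNormedModType R[i])
    (ip : {dot H for Num.conj}) (ip_norm : forall x : H, ip x x = `|x| ^+ 2)
    (kappa : nat) (D : set R[i]) (Q : R[i] -> bop H) :
  gen_nevanlinna ip kappa D Q ->
  holomorphic_at_infty D Q ->
  bop_invertible (deriv_infty Q) ->
  ker_family D Q = [set 0].
Proof.
move=> _ Qoo [B [QB _]]; apply/seteqP; split=> [h kh|_ -> z _] /=; last first.
  exact: bopr0.
suff Qh : deriv_infty Q h = 0 by rewrite -(QB h) Qh bopr0.
apply: (@bop_lim_eq0 _ _ _ _ cinfty_nbhs_filter (fun z => z *: Q z)).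
  (* [cvg] unfolds to convergence to [lim], here [deriv_infty Q]. *)
  by case: Qoo.
apply: filterS (holomorphic_at_infty_domain _ _ _ _ Qoo) => z Dz.
by rewrite bopZ (kh z Dz) scaler0.
Qed.
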